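(* Let $\mathfrak g=\mathfrak{sl}(N)$, $N=n+1$, $m\in\mathbb N$, $m\le N/2$, and let $$A=\pm\Bigl(\sum_{i=1}^m q^{-m}(1-q^{-N+2m})e_{ii}+\sum_{m<i<m'}q^{-m}e_{ii}+\sum_{i\le m\text{ or }i'\le m}y_ie_{ii'}\Bigr),\qquad y_iy_{i'}=q^{-N},$$ where $i'=N+1-i$. Let $U_q(\mathfrak k)\subset U_q(\mathfrak g)$ be the subalgebra generated by $e_i,f_i,q^{\pm h_i}$ with $m+1\le i\le n-m$, and by $X_{\alpha_i}=q^{h_{\tilde\alpha_i}-h_{\alpha_i}}e_i+c_{\alpha_i}F_{\tilde\alpha_i}$, $q^{\pm(h_{\tilde\alpha_i}-h_{\alpha_i})}$ for the remaining $i$ (i.e. $i\le m$ or $i\ge N-m$), with the following data: • for $i<m$ or $i>N-m$: $\tilde\alpha_i=\alpha_{N-i}$, $F_{\tilde\alpha_i}=F_{N-i}$, $c_{\alpha_i}=\dfrac{y_{i+1}}{y_i}$; • if $m=\frac N2$: $\tilde\alpha_m=\alpha_m$, $F_{\tilde\alpha_m}=F_m$, $c_{\alpha_m}=\dfrac{q^{-2m+1}}{y_m^2}$; • if $m<\frac N2$: $\tilde\alpha_m=\sum_{l=m+1}^{N-m}\alpha_l$, $\tilde\alpha_{N-m}=\sum_{l=m}^{n-m}\alpha_l$, $$F_{\tilde\alpha_m}=[\dots[F_{m+1},F_{m+2}]_q,\dots,F_{N-m}]_q,\qquad F_{\tilde\alpha_{N-m}}=[\dots[F_m,F_{m+1}]_{q^{-1}},\dots,F_{n-m}]_{q^{-1}},$$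 $$c_{\alpha_m}=\frac{(-1)^{N+1}q^{-N+m}}{y_m},\qquad c_{\alpha_{N-m}}=\frac{(-1)^{N+1}q^{2N-5m-3}}{y_m}.$$ (An iterated commutator with a single entry means that entry.) Then $U_q(\mathfrak k)$ stabilizes $A$: $\pi(x)A=A\pi(x)$ for all $x\in U_q(\mathfrak k)$, where $\pi$ is the natural representation of $U_q(\mathfrak g)$ on $\mathbb C^N$.
   Context: $q\in\mathbb C$ is nonzero and not a root of unity. $U_q(\mathfrak{sl}(n+1))$ is the Drinfeld–Jimbo quantum group with generators $e_i,f_i,q^{\pm h_i}$, $1\le i\le n$, for the simple roots $\alpha_i=\varepsilon_i-\varepsilon_{i+1}$: $q^{h_i}e_jq^{-h_i}=q^{(\alpha_i,\alpha_j)}e_j$, $q^{h_i}f_jq^{-h_i}=q^{-(\alpha_i,\alpha_j)}f_j$, $[e_i,f_j]=\delta_{ij}\frac{q^{h_i}-q^{-h_i}}{q-q^{-1}}$, the $q^{\pm h_i}$ commute, plus the quantum Serre relations. For $\beta=\sum k_i\alpha_i$, $q^{h_\beta}=\prod_i(q^{h_i})^{k_i}$. Notation: $F_i=q^{h_i}f_i$, $[x,y]_a=xy-a\,yx$. The natural representation $\pi:U_q(\mathfrak g)\to\mathrm{End}(\mathbb C^N)$ is $e_i\mapsto e_{i,i+1}$, $f_i\mapsto e_{i+1,i}$, $q^{h_i}\mapsto\sum_jq^{\delta_{ji}-\delta_{j,i+1}}e_{jj}$, where $e_{ij}$ with two indices are matrix units. *)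

(* Defs.v *)
From HB Require Import structures.
From mathcomp Require Import all_boot all_order all_algebra.
From mathcomp Require Import boolp reals.
From mathcomp Require Import complex.
From mathcomp Require Import zify.

Set Implicit Arguments.
Unset Strict Implicit.
Unset Printing Implicit Defensive.

Import Order.TTheory GRing.Theory Num.Theory.
Local Open Scope ring_scope.
Local Open Scope quotient_scope.

(* Associative unital algebras presented by generators and relations.         *)
(* [presented rel] is the quotient of formal noncommutative polynomials over  *)
(* X by the least congruence [alg_eq rel] that contains [rel] and the axioms  *)
(* of associative unital F-algebras.                                          *)

Inductive alg_term (F X : Type) : Type :=
| TGen of X
| TZero
| TOne
| TAdd of alg_term F X & alg_term F X
| TOpp of alg_term F X
| TMul of alg_term F X & alg_term F X
| TScale of F & alg_term F X.

Arguments TGen {F X}.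
Arguments TZero {F X}.
Arguments TOne {F X}.

HB.instance Definition _ (F X : Type) := gen_eqMixin (alg_term F X).
HB.instance Definition _ (F X : Type) := gen_choiceMixin (alg_term F X).

Section Presented.

Variables (F : fieldType) (X : Type).
Variable rel : alg_term F X -> alg_term F X -> Prop.

Inductive alg_eq : alg_term F X -> alg_term F X -> Prop :=
| alg_eq_rel t u : rel t u -> alg_eq t u
| alg_eq_refl t : alg_eq t t
| alg_eq_sym t u : alg_eq t u -> alg_eq u t
| alg_eq_trans t u v : alg_eq t u -> alg_eq u v -> alg_eq t v
| alg_eq_add t t' u u' :
    alg_eq t t' -> alg_eq u u' -> alg_eq (TAdd t u) (TAdd t' u')
| alg_eq_opp t t' : alg_eq t t' -> alg_eq (TOpp t) (TOpp t')
| alg_eq_mul t t' u u' :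
    alg_eq t t' -> alg_eq u u' -> alg_eq (TMul t u) (TMul t' u')
| alg_eq_scale a t t' : alg_eq t t' -> alg_eq (TScale a t) (TScale a t')
| alg_eq_addA t u v : alg_eq (TAdd t (TAdd u v)) (TAdd (TAdd t u) v)
| alg_eq_addC t u : alg_eq (TAdd t u) (TAdd u t)
| alg_eq_add0 t : alg_eq (TAdd TZero t) t
| alg_eq_addN t : alg_eq (TAdd (TOpp t) t) TZero
| alg_eq_mulA t u v : alg_eq (TMul t (TMul u v)) (TMul (TMul t u) v)
| alg_eq_mul1l t : alg_eq (TMul TOne t) t
| alg_eq_mul1r t : alg_eq (TMul t TOne) t
| alg_eq_mulDl t u v :
    alg_eq (TMul (TAdd t u) v) (TAdd (TMul t v) (TMul u v))
| alg_eq_mulDr t u v :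
    alg_eq (TMul t (TAdd u v)) (TAdd (TMul t u) (TMul t v))
| alg_eq_scaleA a b t :
    alg_eq (TScale a (TScale b t)) (TScale (a * b) t)
| alg_eq_scale1 t : alg_eq (TScale 1 t) t
| alg_eq_scaleDr a t u :
    alg_eq (TScale a (TAdd t u)) (TAdd (TScale a t) (TScale a u))
| alg_eq_scaleDl a b t :
    alg_eq (TScale (a + b) t) (TAdd (TScale a t) (TScale b t))
| alg_eq_scaleAl a t u :
    alg_eq (TScale a (TMul t u)) (TMul (TScale a t) u)
| alg_eq_scaleAr a t u :
    alg_eq (TScale a (TMul t u)) (TMul t (TScale a u)).

Definition alg_eqb (t u : alg_term F X) : bool := `[< alg_eq t u >].

Lemma alg_eqb_refl : reflexive alg_eqb.
Proof. by move=> t; apply/asboolP; apply: alg_eq_refl. Qed.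

Lemma alg_eqb_sym : symmetric alg_eqb.
Proof. by move=> t u; apply/asboolP/asboolP; apply: alg_eq_sym. Qed.

Lemma alg_eqb_trans : transitive alg_eqb.
Proof.
move=> u t v /asboolP tu /asboolP uv.
by apply/asboolP; apply: alg_eq_trans tu uv.
Qed.

Canonical alg_eqb_equiv := EquivRel alg_eqb alg_eqb_refl alg_eqb_sym alg_eqb_trans.

Definition presented := {eq_quot alg_eqb}.
HB.instance Definition _ := Choice.on presented.
HB.instance Definition _ : EqQuotient (alg_term F X) alg_eqb presented :=
  EqQuotient.on presented.

Definition pcls (t : alg_term F X) : presented := \pi_presented t.

Lemma pclsP (t u : alg_term F X) : alg_eq t u <-> pcls t = pcls u.
Proof.
split=> [tu|/eqquotP/asboolP //].
by apply/eqquotP; apply/asboolP.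
Qed.

Lemma pcls_repr (x : presented) : pcls (repr x) = x.
Proof. exact: reprK. Qed.

Lemma repr_pcls (t : alg_term F X) : alg_eq (repr (pcls t)) t.
Proof. by apply/pclsP; rewrite pcls_repr. Qed.

Lemma presentedW (P : presented -> Prop) :
  (forall t, P (pcls t)) -> forall x, P x.
Proof. by move=> h x; rewrite -[x]pcls_repr. Qed.

Definition padd (x y : presented) := pcls (TAdd (repr x) (repr y)).
Definition popp (x : presented) := pcls (TOpp (repr x)).
Definition pmul (x y : presented) := pcls (TMul (repr x) (repr y)).
Definition pscale (a : F) (x : presented) := pcls (TScale a (repr x)).

Lemma pcls_add t u : padd (pcls t) (pcls u) = pcls (TAdd t u).
Proof. by apply/pclsP/alg_eq_add; apply: repr_pcls. Qed.
Lemma pcls_opp t : popp (pcls t) = pcls (TOpp t).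
Proof. by apply/pclsP/alg_eq_opp; apply: repr_pcls. Qed.
Lemma pcls_mul t u : pmul (pcls t) (pcls u) = pcls (TMul t u).
Proof. by apply/pclsP/alg_eq_mul; apply: repr_pcls. Qed.
Lemma pcls_scale a t : pscale a (pcls t) = pcls (TScale a t).
Proof. by apply/pclsP/alg_eq_scale; apply: repr_pcls. Qed.

Let pE := (pcls_add, pcls_opp, pcls_mul, pcls_scale).

Lemma paddA : associative padd.
Proof.
do 3 elim/presentedW => ?; rewrite !pE.
by apply/pclsP; apply: alg_eq_addA.
Qed.
Lemma paddC : commutative padd.
Proof.
by do 2 elim/presentedW => ?; rewrite !pE; apply/pclsP; apply: alg_eq_addC.
Qed.
Lemma padd0 : left_id (pcls TZero) padd.
Proof. by elim/presentedW => ?; rewrite !pE; apply/pclsP; apply: alg_eq_add0. Qed.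
Lemma paddN : left_inverse (pcls TZero) popp padd.
Proof. by elim/presentedW => ?; rewrite !pE; apply/pclsP; apply: alg_eq_addN. Qed.

HB.instance Definition _ := GRing.isZmodule.Build presented paddA paddC padd0 paddN.

Lemma pmulA : associative pmul.
Proof.
by do 3 elim/presentedW => ?; rewrite !pE; apply/pclsP; apply: alg_eq_mulA.
Qed.
Lemma pmul1l : left_id (pcls TOne) pmul.
Proof. by elim/presentedW => ?; rewrite !pE; apply/pclsP; apply: alg_eq_mul1l. Qed.
Lemma pmul1r : right_id (pcls TOne) pmul.
Proof. by elim/presentedW => ?; rewrite !pE; apply/pclsP; apply: alg_eq_mul1r. Qed.
Lemma pmulDl : left_distributive pmul (@GRing.add presented).
Proof.
do 3 elim/presentedW => ?; rewrite /GRing.add /= !pE.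
by apply/pclsP; apply: alg_eq_mulDl.
Qed.
Lemma pmulDr : right_distributive pmul (@GRing.add presented).
Proof.
do 3 elim/presentedW => ?; rewrite /GRing.add /= !pE.
by apply/pclsP; apply: alg_eq_mulDr.
Qed.

HB.instance Definition _ :=
  GRing.Zmodule_isPzRing.Build presented pmulA pmul1l pmul1r pmulDl pmulDr.

Lemma pscaleA a b x : pscale a (pscale b x) = pscale (a * b) x.
Proof.
by elim/presentedW: x => ?; rewrite !pE; apply/pclsP; apply: alg_eq_scaleA.
Qed.
Lemma pscale1 : left_id 1 pscale.
Proof. by elim/presentedW => ?; rewrite !pE; apply/pclsP; apply: alg_eq_scale1. Qed.
Lemma pscaleDr : right_distributive pscale (@GRing.add presented).
Proof.
move=> a; do 2 elim/presentedW => ?; rewrite /GRing.add /= !pE.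
by apply/pclsP; apply: alg_eq_scaleDr.
Qed.
Lemma pscaleDl (x : presented) : {morph pscale^~ x : a b / a + b}.
Proof.
move=> a b; elim/presentedW: x => ?; rewrite {2}/GRing.add /= !pE.
by apply/pclsP; apply: alg_eq_scaleDl.
Qed.

HB.instance Definition _ :=
  GRing.Zmodule_isLmodule.Build F presented pscaleA pscale1 pscaleDr pscaleDl.

Lemma presented_scaleAl (a : F) (x y : presented) : a *: (x * y) = (a *: x) * y.
Proof.
elim/presentedW: x => ?; elim/presentedW: y => ?.
rewrite /GRing.mul /GRing.scale /= !pE.
by apply/pclsP; apply: alg_eq_scaleAl.
Qed.
Lemma presented_scaleAr (a : F) (x y : presented) : a *: (x * y) = x * (a *: y).
Proof.
elim/presentedW: x => ?; elim/presentedW: y => ?.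
rewrite /GRing.mul /GRing.scale /= !pE.
by apply/pclsP; apply: alg_eq_scaleAr.
Qed.

Lemma pcls0 : pcls TZero = 0. Proof. by []. Qed.
Lemma pcls1 : pcls TOne = 1. Proof. by []. Qed.
Lemma pclsD t u : pcls (TAdd t u) = pcls t + pcls u.
Proof. by rewrite -pcls_add. Qed.
Lemma pclsN t : pcls (TOpp t) = - pcls t.
Proof. by rewrite -pcls_opp. Qed.
Lemma pclsM t u : pcls (TMul t u) = pcls t * pcls u.
Proof. by rewrite -pcls_mul. Qed.
Lemma pclsZ a t : pcls (TScale a t) = a *: pcls t.
Proof. by rewrite -pcls_scale. Qed.

Section Lift.

Variables (B : algType F) (v : X -> B).

Fixpoint alg_eval (t : alg_term F X) : B :=
  match t with
  | TGen g => v g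
  | TZero => 0
  | TOne => 1
  | TAdd t u => alg_eval t + alg_eval u
  | TOpp t => - alg_eval t
  | TMul t u => alg_eval t * alg_eval u
  | TScale a t => a *: alg_eval t
  end.

Hypothesis v_rel : forall t u, rel t u -> alg_eval t = alg_eval u.

Lemma alg_eval_eq t u : alg_eq t u -> alg_eval t = alg_eval u.
Proof.
elim=> //=.
- by move=> ? ? ? _ -> _ ->.
- by move=> ? ? ? ? _ -> _ ->.
- by move=> ? ? _ ->.
- by move=> ? ? ? ? _ -> _ ->.
- by move=> ? ? ? _ ->.
- by move=> *; rewrite addrA.
- by move=> *; rewrite addrC.
- by move=> *; rewrite add0r.
- by move=> *; rewrite addNr.
- by move=> *; rewrite mulrA.
- by move=> *; rewrite mul1r.
- by move=> *; rewrite mulr1.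
- by move=> *; rewrite mulrDl.
- by move=> *; rewrite mulrDr.
- by move=> *; rewrite scalerA.
- by move=> *; rewrite scale1r.
- by move=> *; rewrite scalerDr.
- by move=> *; rewrite scalerDl.
- by move=> *; rewrite scalerAl.
- by move=> *; rewrite scalerAr.
Qed.

Definition plift (x : presented) : B := alg_eval (repr x).

Lemma plift_cls t : plift (pcls t) = alg_eval t.
Proof. by apply: alg_eval_eq; apply: repr_pcls. Qed.

Lemma plift1 : plift 1 = 1.
Proof. by rewrite -pcls1 plift_cls. Qed.
Lemma pliftM : {morph plift : x y / x * y}.
Proof. by do 2 elim/presentedW => ?; rewrite -pclsM !plift_cls. Qed.
Lemma plift_linear : linear plift.
Proof.
by move=> a; do 2 elim/presentedW => ?; rewrite -pclsZ -pclsD !plift_cls.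
Qed.

End Lift.

End Presented.

(* The quantum group U_q(sl(n+1)).  The ordinal i : 'I_n stands for the       *)
(* simple root alpha_{i+1}; [cartan i j] is (alpha_i, alpha_j), which only    *)
(* depends on the difference of the indices.                                  *)

Definition cartan (i j : nat) : int :=
  if i == j then 2 else if (i.+1 == j) || (j.+1 == i) then -1 else 0.

Inductive Ugen (n : nat) : Type :=
| GenE of 'I_n | GenF of 'I_n | GenK of 'I_n | GenKinv of 'I_n.

Section QuantumGroup.

Variables (F : fieldType) (n : nat) (q : F).

Let e (i : 'I_n) : alg_term F (Ugen n) := TGen (GenE i).
Let f (i : 'I_n) : alg_term F (Ugen n) := TGen (GenF i).
Let k (i : 'I_n) : alg_term F (Ugen n) := TGen (GenK i).
Let ki (i : 'I_n) : alg_term F (Ugen n) := TGen (GenKinv i).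

(* x^2 y - (q + q^-1) x y x + y x^2 *)
Definition serre_term (x y : alg_term F (Ugen n)) :=
  TAdd (TAdd (TMul (TMul x x) y)
             (TOpp (TScale (q + q^-1) (TMul (TMul x y) x))))
       (TMul y (TMul x x)).

Inductive Uq_rel : alg_term F (Ugen n) -> alg_term F (Ugen n) -> Prop :=
| Uq_KKinv (i : 'I_n) : Uq_rel (TMul (k i) (ki i)) TOne
| Uq_KinvK (i : 'I_n) : Uq_rel (TMul (ki i) (k i)) TOne
| Uq_KK (i j : 'I_n) : Uq_rel (TMul (k i) (k j)) (TMul (k j) (k i))
| Uq_KE (i j : 'I_n) :
    Uq_rel (TMul (TMul (k i) (e j)) (ki i)) (TScale (q ^ cartan i j) (e j))
| Uq_KF (i j : 'I_n) :
    Uq_rel (TMul (TMul (k i) (f j)) (ki i)) (TScale (q ^ (- cartan i j)) (f j))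
| Uq_EF (i j : 'I_n) :
    Uq_rel (TAdd (TMul (e i) (f j)) (TOpp (TMul (f j) (e i))))
           (if i == j then TScale (q - q^-1)^-1 (TAdd (k i) (TOpp (ki i)))
            else TZero)
| Uq_EE (i j : 'I_n) : cartan i j = 0 -> Uq_rel (TMul (e i) (e j)) (TMul (e j) (e i))
| Uq_FF (i j : 'I_n) : cartan i j = 0 -> Uq_rel (TMul (f i) (f j)) (TMul (f j) (f i))
| Uq_serreE (i j : 'I_n) : cartan i j = -1 -> Uq_rel (serre_term (e i) (e j)) TZero
| Uq_serreF (i j : 'I_n) : cartan i j = -1 -> Uq_rel (serre_term (f i) (f j)) TZero.

Definition Uq : Type := presented Uq_rel.
HB.instance Definition _ := GRing.PzRing.on Uq.
HB.instance Definition _ := GRing.Lmodule.on Uq.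

Definition counit_gen (g : Ugen n) : F^o :=
  match g with GenE _ | GenF _ => 0 | GenK _ | GenKinv _ => 1 end.

Lemma counit_rel t u :
  Uq_rel t u -> alg_eval counit_gen t = alg_eval counit_gen u.
Proof.
case=> //= *; rewrite ?(mulr0, mul0r, mulr1, scaler0, subrr, oppr0, addr0) //.
by case: ifP => //= _; rewrite subrr scaler0.
Qed.

Lemma Uq_1_neq0 : (1 : Uq) != 0.
Proof.
apply/eqP => /(congr1 (plift counit_gen)).
rewrite -[1]pcls1 -[0]pcls0 !(plift_cls counit_rel) /= => /eqP.
by rewrite oner_eq0.
Qed.

HB.instance Definition _ := GRing.PzSemiRing_isNonZero.Build Uq Uq_1_neq0.
HB.instance Definition _ :=
  GRing.Lmodule_isLalgebra.Build F Uq (@presented_scaleAl F _ Uq_rel).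
HB.instance Definition _ :=
  GRing.Lalgebra_isAlgebra.Build F Uq (@presented_scaleAr F _ Uq_rel).

(* Generators and Cartan elements with 1-based indices, as on paper: the      *)
(* index i ranges over 1 <= i <= n, and the value is 0 outside this range.    *)
Definition Ugen_at (g : 'I_n -> Ugen n) (i : nat) : Uq :=
  if i is i'.+1 then oapp (fun j => pcls Uq_rel (TGen (g j))) 0 (insub i')
  else 0.

Definition Ue := Ugen_at (@GenE n).
Definition Uf := Ugen_at (@GenF n).
Definition UK := Ugen_at (@GenK n).
Definition UKinv := Ugen_at (@GenKinv n).

(* The root lattice; the coordinate j : 'I_n is the coefficient of            *)
(* alpha_{j+1}.                                                               *)
Definition root_lattice := {ffun 'I_n -> int}.
Definition alpha (i : nat) : root_lattice := [ffun j : 'I_n => (j.+1 == i)%:Z].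

Definition UKz (i : nat) (z : int) : Uq :=
  match z with Posz k => UK i ^+ k | Negz k => UKinv i ^+ k.+1 end.

(* q^{h_beta}; the factors commute by Uq_KK. *)
Definition qh (beta : root_lattice) : Uq := \prod_(j < n) UKz j.+1 (beta j).

(* F_i = q^{h_i} f_i *)
Definition UF (i : nat) : Uq := UK i * Uf i.

End QuantumGroup.

(* [x, y]_a = x y - a y x *)
Definition qcomm (F : fieldType) (B : algType F) (a : F) (x y : B) : B :=
  x * y - a *: (y * x).

(* [... [x_lo, x_{lo+1}]_a, ..., x_hi]_a *)
Definition iter_qcomm (F : fieldType) (B : algType F) (a : F) (x : nat -> B)
    (lo hi : nat) : B :=
  foldl (fun z l => qcomm a z (x l)) (x lo) (iota lo.+1 (hi - lo)).

(* The matrix unit e_ab with 1-based indices, 1 <= a, b <= N. *)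
Definition munit (R : pzRingType) (N a b : nat) : 'M[R]_N :=
  \matrix_(i < N, j < N) ((i.+1 == a) && (j.+1 == b))%:R.

Arguments munit {R N}.

Section NaturalRep.

Variables (F : fieldType) (n : nat) (q : F).

Definition natrep_gen (g : Ugen n) : 'M[F]_n.+1 :=
  match g with
  | GenE i => munit i.+1 i.+2
  | GenF i => munit i.+2 i.+1
  | GenK i =>
      \sum_(1 <= j < n.+2) q ^ ((j == i.+1)%:Z - (j == i.+2)%:Z) *: munit j j
  | GenKinv i =>
      \sum_(1 <= j < n.+2) q ^ (- ((j == i.+1)%:Z - (j == i.+2)%:Z)) *: munit j j
  end.

Lemma munitM (a b c d : nat) :
  (munit a b : 'M[F]_n.+1) * munit c d =
  ((b == c) && (1 <= b <= n.+1)%N)%:R *: munit a d.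
Proof.
apply/matrixP => i j; rewrite !mxE.
case: (boolP (_ && _)) => [/andP[/eqP <- /andP[b0 bn]]|H].
  have bo : (b.-1 < n.+1)%N by rewrite prednK.
  rewrite (bigD1 (Ordinal bo)) //= big1 ?addr0 ?mul1r ?mxE /=.
    by rewrite prednK // eqxx andbT /= -natrM mulnb.
  move=> l lb; rewrite !mxE; suff -> : (l.+1 == b) = false by rewrite andbF mul0r.
  apply/negbTE; apply: contraNN lb => /eqP lb.
  by apply/eqP/val_inj => /=; rewrite -lb.
rewrite mul0r big1 // => l _; rewrite !mxE.
case: (l.+1 =P b) => [lb|]; last by rewrite andbF mul0r.
case: (l.+1 =P c) => [lc|]; last by rewrite mulr0.
case/negP: H; rewrite -lc -lb eqxx /=; exact: ltn_ord.
Qed.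

Lemma munitM0 (a b c d : nat) :
  (b == c) = false -> (munit a b : 'M[F]_n.+1) * munit c d = 0.
Proof. by move=> bc; rewrite munitM bc scale0r. Qed.

Lemma serre0 (c : F) (x y : 'M[F]_n.+1) :
  x * x = 0 -> x * y = 0 \/ y * x = 0 ->
  x * x * y - c *: (x * y * x) + y * (x * x) = 0.
Proof.
move=> xx xyx; rewrite xx mul0r mulr0 addr0.
suff -> : x * y * x = 0 by rewrite scaler0 subrr.
by case: xyx => [->|yx]; rewrite ?mul0r // -mulrA yx mulr0.
Qed.

Definition dmx (w : nat -> F) : 'M[F]_n.+1 :=
  \sum_(1 <= j < n.+2) w j *: munit j j.

Lemma dmxE w : dmx w = diag_mx (\row_j w j.+1).
Proof.
apply/matrixP => a b; rewrite /dmx summxE big_add1 /= big_mkord !mxE.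
rewrite (bigD1 a) //= big1 ?addr0; last first.
  by move=> j ja; rewrite !mxE /= eqSS val_eqE eq_sym (negbTE ja) mulr0.
by rewrite !mxE eqxx /= eqSS eq_sym val_eqE mulr_natr.
Qed.

Lemma dmxM w w' : dmx w * dmx w' = dmx (fun j => w j * w' j).
Proof.
rewrite !dmxE [LHS]mulmx_diag; congr diag_mx.
by apply/rowP => j; rewrite !mxE.
Qed.

Lemma eq_dmx w w' : w =1 w' -> dmx w = dmx w'.
Proof. by move=> ww'; apply: eq_bigr => j _; rewrite ww'. Qed.

Lemma dmx1 : dmx (fun=> 1) = 1.
Proof. by rewrite dmxE; apply/matrixP => a b; rewrite !mxE. Qed.

Lemma dmx_munit w a b : dmx w * munit a b = w a *: munit a b.
Proof.
apply/matrixP => i j; rewrite dmxE [_ * _]mul_diag_mx !mxE.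
by case: eqP => [->|]; rewrite ?mulr0.
Qed.

Lemma munit_dmx w a b : munit a b * dmx w = w b *: munit a b.
Proof.
apply/matrixP => i j; rewrite dmxE [_ * _]mul_mx_diag !mxE mulrC.
by case: (j.+1 =P b) => [->|]; rewrite ?andbF ?mulr0.
Qed.

Hypothesis q_neq0 : q != 0.
Hypothesis q_nroot : forall k : nat, (0 < k)%N -> ~~ k.-unity_root q.

Lemma subq_neq0 : q - q^-1 != 0.
Proof.
rewrite subr_eq0; apply: contraNneq (q_nroot (isT : (0 < 2)%N)) => qV.
by apply/unity_rootP; rewrite expr2 {2}qV divff.
Qed.

Let w (i : nat) (j : nat) : F := q ^ ((j == i.+1)%:Z - (j == i.+2)%:Z).
Let w' (i : nat) (j : nat) : F := q ^ (- ((j == i.+1)%:Z - (j == i.+2)%:Z)).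

Lemma natrep_KKinv i : dmx (w i) * dmx (w' i) = 1.
Proof.
rewrite dmxM -dmx1; apply: eq_dmx => j.
by rewrite -expfzDr // subrr expr0z.
Qed.

Lemma natrep_cartanE (i j : nat) : w i j.+1 * w' i j.+2 = q ^ cartan i j.
Proof.
rewrite -expfzDr // /cartan !eqSS; congr (q ^ _).
by do ![case: eqP => ? //=]; lia.
Qed.

Lemma natrep_cartanF (i j : nat) : w i j.+2 * w' i j.+1 = q ^ (- cartan i j).
Proof.
rewrite -expfzDr // /cartan !eqSS; congr (q ^ _).
by do ![case: eqP => ? //=]; lia.
Qed.

Lemma cartan_eq0 (i j : nat) :
  cartan i j = 0 -> (i.+1 == j) = false /\ (j.+1 == i) = false.
Proof. by rewrite /cartan; do ![case: eqP => ? //=]. Qed.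

Lemma natrep_EF (i : 'I_n) :
  munit i.+1 i.+1 - munit i.+2 i.+2 =
  (q - q^-1)^-1 *: (dmx (w i) - dmx (w' i)) :> 'M[F]_n.+1.
Proof.
apply: (scalerI subq_neq0); rewrite scalerA divff ?subq_neq0 // scale1r.
apply/matrixP => a b; rewrite !dmxE !mxE.
case: (a =P b) => [->|ab]; last first.
  have H c : (a.+1 == c) && (b.+1 == c) = false.
    by apply/negP => /andP[/eqP <- /eqP[/val_inj]] /esym.
  by rewrite !H !mulrb !subrr mulr0.
rewrite !andbb /w /w' !eqSS !mulrb.
have [->|ni] := eqVneq (val b) i.
  by rewrite ltn_eqF //= !subr0 mulr1 expr1z exprN1.
case: eqP => _ /=; last first.
  by rewrite !subr0 oppr0 mulr0 expr0z subrr.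
by rewrite !sub0r opprK mulrN1 opprB expr1z exprN1.
Qed.

Lemma natrep_rel t u :
  @Uq_rel F n q t u -> alg_eval natrep_gen t = alg_eval natrep_gen u.
Proof.
case=> {t u} [i|i|i j|i j|i j|i j|i j|i j|i j|i j] /=.
- exact: natrep_KKinv.
- rewrite -[RHS](natrep_KKinv i) -!/(dmx _) !dmxM.
  by apply: eq_dmx => l; rewrite mulrC.
- by rewrite -!/(dmx _) !dmxM; apply: eq_dmx => l; rewrite mulrC.
- rewrite -!/(dmx _) dmx_munit -scalerAl munit_dmx scalerA.
  by rewrite -natrep_cartanE.
- rewrite -!/(dmx _) dmx_munit -scalerAl munit_dmx scalerA.
  by rewrite -natrep_cartanF.
- rewrite !munitM !eqSS !ltnS (ltn_ord i) (ltnW (ltn_ord j)) !andbT.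
  rewrite [(j == i :> nat)]eq_sym val_eqE; case: eqP => [->|_] /=.
    by rewrite !scale1r -natrep_EF.
  by rewrite !scale0r subrr.
- move=> /cartan_eq0[ij ji].
  by rewrite !munitM !eqSS ij ji !scale0r.
- move=> /cartan_eq0[ij ji].
  by rewrite !munitM !eqSS eq_sym ji eq_sym ij !scale0r.
- move=> _; apply: serre0; first by apply: munitM0; lia.
  by case: (i.+1 =P j) => ij; [right|left]; apply: munitM0; lia.
- move=> _; apply: serre0; first by apply: munitM0; lia.
  by case: (j.+1 =P i) => ij; [right|left]; apply: munitM0; lia.
Qed.

End NaturalRep.

(* The relation between e_i and f_i is preserved by the matrices natrep_gen   *)
(* only when q is admissible, so natrep carries the assumptions on q.         *)
Definition natrep (F : fieldType) (n : nat) (q : F) (q_neq0 : q != 0)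
    (q_nroot : forall k : nat, (0 < k)%N -> ~~ k.-unity_root q)
    (x : Uq n q) : 'M[F]_n.+1 :=
  plift (natrep_gen q) x.

Section NaturalRepTheory.

Variables (F : fieldType) (n : nat) (q : F).
Hypothesis q_neq0 : q != 0.
Hypothesis q_nroot : forall k : nat, (0 < k)%N -> ~~ k.-unity_root q.

Local Notation pi := (@natrep F n q q_neq0 q_nroot).

Lemma natrep_monoid_morphism : monoid_morphism pi.
Proof.
split; first exact: (plift1 (natrep_rel q_neq0 q_nroot)).
exact: (pliftM (natrep_rel q_neq0 q_nroot)).
Qed.

Lemma natrep_linear : linear pi.
Proof. exact: (plift_linear (natrep_rel q_neq0 q_nroot)). Qed.

HB.instance Definition _ :=
  GRing.isLinear.Build F (Uq n q) 'M[F]_n.+1 *:%R pi natrep_linear.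
HB.instance Definition _ :=
  GRing.isMonoidMorphism.Build (Uq n q) 'M[F]_n.+1 pi natrep_monoid_morphism.

Lemma natrep_at (g : 'I_n -> Ugen n) (i : 'I_n) :
  pi (Ugen_at q g i.+1) = natrep_gen q (g i).
Proof.
rewrite /Ugen_at valK /=.
exact: (plift_cls (natrep_rel q_neq0 q_nroot)).
Qed.

Lemma natrep_e (i : nat) : (1 <= i <= n)%N -> pi (Ue n q i) = munit i i.+1.
Proof. by case: i => // i lt_in; rewrite (natrep_at _ (Ordinal lt_in)). Qed.

Lemma natrep_f (i : nat) : (1 <= i <= n)%N -> pi (Uf n q i) = munit i.+1 i.
Proof. by case: i => // i lt_in; rewrite (natrep_at _ (Ordinal lt_in)). Qed.

Lemma natrep_K (i : nat) : (1 <= i <= n)%N ->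
  pi (UK n q i) =
  \sum_(1 <= j < n.+2) q ^ ((j == i)%:Z - (j == i.+1)%:Z) *: munit j j.
Proof. by case: i => // i lt_in; rewrite (natrep_at _ (Ordinal lt_in)). Qed.

Lemma natrep_Kinv (i : nat) : (1 <= i <= n)%N ->
  pi (UKinv n q i) =
  \sum_(1 <= j < n.+2) q ^ (- ((j == i)%:Z - (j == i.+1)%:Z)) *: munit j j.
Proof. by case: i => // i lt_in; rewrite (natrep_at _ (Ordinal lt_in)). Qed.

End NaturalRepTheory.

Inductive gen_subalg (F : fieldType) (B : algType F) (S : B -> Prop) : B -> Prop :=
| gen_subalg_gen x : S x -> gen_subalg S x
| gen_subalg_one : gen_subalg S 1
| gen_subalg_add x y : gen_subalg S x -> gen_subalg S y -> gen_subalg S (x + y)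
| gen_subalg_mul x y : gen_subalg S x -> gen_subalg S y -> gen_subalg S (x * y)
| gen_subalg_scale a x : gen_subalg S x -> gen_subalg S (a *: x).

(* All indices are 1-based; y_i is only used for i <= m or N + 1 - i <= m.    *)

Section CoidealSubalgebra.

Variables (F : fieldType) (n : nat) (q : F) (m : nat) (y : nat -> F).

Local Notation N := n.+1.

Definition tilde_alpha (i : nat) : root_lattice n :=
  if (i < m)%N || (N - m < i)%N then alpha n (N - i)
  else if N == m.*2 then alpha n m
  else if i == m then \sum_(m.+1 <= l < (N - m).+1) alpha n l
  else (* i = N - m *) \sum_(m <= l < (n - m).+1) alpha n l.

Definition tilde_F (i : nat) : Uq n q :=
  if (i < m)%N || (N - m < i)%N then UF n q (N - i)
  else if N == m.*2 then UF n q m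
  else if i == m then iter_qcomm q (UF n q) m.+1 (N - m)
  else (* i = N - m *) iter_qcomm q^-1 (UF n q) m (n - m).

Definition c_alpha (i : nat) : F :=
  if (i < m)%N || (N - m < i)%N then y i.+1 / y i
  else if N == m.*2 then q ^ (- (2 * m)%:Z + 1) / y m ^+ 2
  else if i == m then (-1) ^+ N.+1 * q ^ (- N%:Z + m%:Z) / y m
  else (* i = N - m *)
    (-1) ^+ N.+1 * q ^ ((2 * N)%:Z - (5 * m)%:Z - 3) / y m.

Inductive Uk_gen : Uq n q -> Prop :=
| Uk_e i : (m.+1 <= i <= n - m)%N -> Uk_gen (Ue n q i)
| Uk_f i : (m.+1 <= i <= n - m)%N -> Uk_gen (Uf n q i)
| Uk_K i : (m.+1 <= i <= n - m)%N -> Uk_gen (UK n q i)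
| Uk_Kinv i : (m.+1 <= i <= n - m)%N -> Uk_gen (UKinv n q i)
| Uk_X i : (1 <= i <= n)%N -> (i <= m)%N || (N - m <= i)%N ->
    Uk_gen (qh q (tilde_alpha i - alpha n i) * Ue n q i
            + c_alpha i *: tilde_F i)
| Uk_T i : (1 <= i <= n)%N -> (i <= m)%N || (N - m <= i)%N ->
    Uk_gen (qh q (tilde_alpha i - alpha n i))
| Uk_Tinv i : (1 <= i <= n)%N -> (i <= m)%N || (N - m <= i)%N ->
    Uk_gen (qh q (- (tilde_alpha i - alpha n i))).

Definition Uk : Uq n q -> Prop := gen_subalg Uk_gen.

(* The matrix A up to the overall sign. *)
Definition A_mx : 'M[F]_N :=
  \sum_(1 <= i < m.+1)
     (q ^ (- m%:Z) * (1 - q ^ (- N%:Z + (2 * m)%:Z))) *: munit i i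
  + \sum_(m.+1 <= i < N.+1 - m) q ^ (- m%:Z) *: munit i i
  + \sum_(1 <= i < N.+1 | (i <= m)%N || (N.+1 - i <= m)%N)
     y i *: munit i (N.+1 - i).

End CoidealSubalgebra.

(* Main.v *)
Require Import Defs.
From HB Require Import structures.
From mathcomp Require Import all_boot all_order all_algebra.
From mathcomp Require Import reals.
From mathcomp Require Import complex.
From mathcomp Require Import zify ring.

Set Implicit Arguments.
Unset Strict Implicit.
Unset Printing Implicit Defensive.

Import Order.TTheory GRing.Theory Num.Theory.
Local Open Scope ring_scope.

(* Write A = D + Y with D diagonal and Y antidiagonal.  Right multiplication  *)
(* by A sends e_ij to a combination of e_ij and e_ij', left multiplication to *)
(* a combination of e_ij and e_i'j.  A diagonal matrix commutes with A as     *)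
(* soon as its entries agree at i and i' for all i <= m; this disposes of the *)
(* Cartan elements, through the weights of tilde alpha_i - alpha_i.  Since    *)
(* iterated q-commutators of the matrices of the F_l collapse to a single     *)
(* matrix unit, X_{alpha_i} acts as u e_{i,i+1} + v e_kl, and commuting with  *)
(* A amounts to a few scalar identities between u, v, the y_i and the powers  *)
(* of q: they are what fixes c_{alpha_i}.                                     *)

(** The matrices commuting with $A$ form a subalgebra, unchanged under $A\mapsto -A$, so only the
    generators of $U_q(\mathfrak k)$ matter ([Uk_comm]). Those with $m<i\le n-m$ are supported on
    the middle block, where $A$ is the scalar $q^{-m}$, or are diagonal and equal to 1 outside it.
    The Cartan elements are covered by [wt_tilde_sub_sym]. For $X_{\alpha_i}$ there are two
    mechanisms. For $i<m$, $i>N-m$ or $m=N/2$, its two matrix units are exchanged by $i\mapsto i'$,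
    and $c_{\alpha_i}$ balances the antidiagonal entries ([UX_comm_outer], [UX_comm_half]). If
    $m<N/2$ and $i\in\{m,N-m\}$, its two matrix units share a column or a row of the middle block,
    and $c_{\alpha_i}$ makes it a right or left eigenvector of $A$ for $q^{-m}$ ([UX_comm_low],
    [UX_comm_high]). *)

Section Antidiagonal.

Variables (F : fieldType) (n : nat).

(** * Diagonal and antidiagonal matrices, and q-commutators of matrix units *)

Definition admx (b : nat -> F) : 'M[F]_n.+1 :=
  \sum_(1 <= i < n.+2) b i *: munit i (n.+2 - i).

Lemma admx_munit b i j : (1 <= i <= n.+1)%N ->
  admx b * munit i j = b (n.+2 - i)%N *: munit (n.+2 - i)%N j.
Proof.
move=> hi; rewrite /admx mulr_suml.
rewrite (bigD1_seq (n.+2 - i)%N) ?iota_uniq ?mem_index_iota //=; last by lia.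
rewrite big_nat_cond big1 ?addr0; last first.
  move=> l /andP[hl li]; rewrite -scalerAl munitM0 ?scaler0 //; lia.
rewrite -scalerAl munitM.
have -> : ((n.+2 - (n.+2 - i) == i) && (1 <= n.+2 - (n.+2 - i) <= n.+1))%N = true.
  lia.
by rewrite scale1r.
Qed.

Lemma munit_admx b i j : (1 <= j <= n.+1)%N ->
  munit i j * admx b = b j *: munit i (n.+2 - j)%N.
Proof.
move=> hj; rewrite /admx mulr_sumr.
rewrite (bigD1_seq j) ?iota_uniq ?mem_index_iota //=.
rewrite big_nat_cond big1 ?addr0; last first.
  move=> l /andP[hl lj]; rewrite -scalerAr munitM0 ?scaler0 //; lia.
by rewrite -scalerAr munitM eqxx hj scale1r.
Qed.

Lemma dmx_admxC w b :
  (forall i, (1 <= i <= n.+1)%N -> b i != 0 -> w i = w (n.+2 - i)%N) ->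
  dmx n w * admx b = admx b * dmx n w.
Proof.
move=> wb; rewrite /admx [LHS]mulr_sumr [RHS]mulr_suml; apply: eq_big_nat => i hi.
rewrite -scalerAr -scalerAl dmx_munit munit_dmx !scalerA.
have [->|bi] := eqVneq (b i) 0; first by rewrite !mul0r.
by rewrite -wb //; lia.
Qed.

Lemma dmxC (w w' : nat -> F) : dmx n w * dmx n w' = dmx n w' * dmx n w.
Proof. by rewrite !dmxM; apply: eq_dmx => i; rewrite mulrC. Qed.

Lemma dmx_exp (w : nat -> F) k : dmx n w ^+ k = dmx n (fun j => w j ^+ k).
Proof.
elim: k => [|k IH]; first by rewrite expr0 -dmx1.
by rewrite exprS IH dmxM; apply: eq_dmx => j; rewrite exprS.
Qed.

Lemma dmx_prod (I : Type) (r : seq I) (w : I -> nat -> F) :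
  \prod_(i <- r) dmx n (w i) = dmx n (fun j => \prod_(i <- r) w i j).
Proof.
elim: r => [|i r IH].
  by rewrite big_nil -dmx1; apply: eq_dmx => j; rewrite big_nil.
by rewrite big_cons IH dmxM; apply: eq_dmx => j; rewrite big_cons.
Qed.

(** In each commutator $[e_{l,lo},e_{l+1,l}]_a$ the first product vanishes and the second is
    $e_{l+1,lo}$, so every step contributes a factor $-as$. *)
Lemma iter_qcomm_munit (a s : F) (lo hi : nat) : (1 <= lo <= hi)%N -> (hi <= n)%N ->
  iter_qcomm a (fun l => s *: munit l.+1 l : 'M[F]_n.+1) lo hi =
  ((- a) ^+ (hi - lo) * s ^+ (hi - lo).+1) *: munit hi.+1 lo.
Proof.
move=> /andP[lo1 lohi]; rewrite -(subnKC lohi); move: (hi - lo)%N => k.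
rewrite addKn /iter_qcomm addKn.
elim: k => [|k IH] hn; first by rewrite addn0 /= mul1r.
rewrite -[X in iota _ X]addn1 iotaD foldl_cat IH /=; last by lia.
rewrite /qcomm -!scalerAl -!scalerAr !munitM.
have -> : ((lo == (lo.+1 + k).+1) && (1 <= lo <= n.+1))%N = false by lia.
have -> : ((lo.+1 + k == (lo + k).+1) && (1 <= lo.+1 + k <= n.+1))%N = true by lia.
rewrite scale0r !scaler0 sub0r scale1r !scalerA -scaleNr addSnnS.
by congr (_ *: _); rewrite !exprS; ring.
Qed.

End Antidiagonal.

(** * Weights and images of generators in the natural representation *)

Section Representation.

Variables (F : fieldType) (n : nat) (q : F).
Hypothesis q_neq0 : q != 0.
Hypothesis q_nroot : forall k : nat, (0 < k)%N -> ~~ k.-unity_root q.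

Local Notation pi := (@natrep F n q q_neq0 q_nroot).

(* The value of beta on the j-th diagonal matrix unit, i.e. (beta, eps_j). *)
Definition wt (beta : root_lattice n) (j : nat) : int :=
  \sum_(l < n) beta l * ((j == l.+1)%:Z - (j == l.+2)%:Z).

Lemma wtB beta gamma j : wt (beta - gamma) j = wt beta j - wt gamma j.
Proof.
by rewrite /wt -sumrB; apply: eq_bigr => l _; rewrite !ffunE mulrBl.
Qed.

Lemma wtN beta j : wt (- beta) j = - wt beta j.
Proof.
by rewrite /wt -sumrN; apply: eq_bigr => l _; rewrite !ffunE mulNr.
Qed.

Lemma wt_sum lo hi (beta : nat -> root_lattice n) j :
  wt (\sum_(lo <= i < hi) beta i) j = \sum_(lo <= i < hi) wt (beta i) j.
Proof.
rewrite /wt exchange_big; apply: eq_bigr => l _ /=.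
by rewrite sum_ffunE mulr_suml.
Qed.

Lemma wt_alpha i j : (1 <= i <= n)%N ->
  wt (alpha n i) j = (j == i)%:Z - (j == i.+1)%:Z.
Proof.
case: i => // i hi; rewrite /wt (bigD1 (Ordinal hi)) //= big1 ?addr0.
  by rewrite ffunE eqxx mul1r.
by move=> l; rewrite -val_eqE /= => /negbTE li; rewrite ffunE eqSS li mul0r.
Qed.

(** The sum of simple roots telescopes to $\varepsilon_{lo}-\varepsilon_{hi}$. *)
Lemma wt_alphas lo hi j : (1 <= lo <= hi)%N -> (hi <= n.+1)%N ->
  wt (\sum_(lo <= i < hi) alpha n i) j = (j == lo)%:Z - (j == hi)%:Z.
Proof.
move=> /andP[lo1 lohi] hin; rewrite wt_sum.
rewrite (telescope_sumr_eq (fun i => - (j == i)%:Z) _ lohi); first by lia.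
by move=> i hi'; rewrite wt_alpha; lia.
Qed.

Lemma natrep_UKz i z : (1 <= i <= n)%N ->
  pi (UKz n q i z) = dmx n (fun j => q ^ (z * ((j == i)%:Z - (j == i.+1)%:Z))).
Proof.
move=> hi; case: z => k /=.
  rewrite rmorphXn /= natrep_K // -/(dmx _ _) dmx_exp; apply: eq_dmx => j.
  by rewrite exprnP exprz_exp mulrC.
rewrite rmorphXn /= natrep_Kinv // -/(dmx _ _) dmx_exp; apply: eq_dmx => j.
by rewrite exprnP exprz_exp NegzE mulNr -mulrN mulrC.
Qed.

Lemma natrep_qh beta : pi (qh q beta) = dmx n (fun j => q ^ wt beta j).
Proof.
rewrite /qh rmorph_prod /=.
under eq_bigr => i _ do rewrite natrep_UKz ?ltn_ord //.
rewrite dmx_prod; apply: eq_dmx => j.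
rewrite /wt; elim/big_rec2: _ => // l x z _ ->.
by rewrite expfzDr.
Qed.

Lemma natrep_UF i : (1 <= i <= n)%N -> pi (UF n q i) = q^-1 *: munit i.+1 i.
Proof.
move=> hi; rewrite rmorphM /= natrep_K // natrep_f // -/(dmx _ _) dmx_munit.
by congr (_ *: _); rewrite eqxx (_ : (i.+1 == i) = false) ?sub0r ?exprN1 //; lia.
Qed.

Lemma natrep_iter_qcomm a (x : nat -> Uq n q) lo hi :
  pi (iter_qcomm a x lo hi) = iter_qcomm a (fun l => pi (x l)) lo hi.
Proof.
rewrite /iter_qcomm; elim: (iota _ _) (x lo) => //= l s IH z.
by rewrite IH /qcomm raddfB /= linearZ /= !rmorphM.
Qed.

Lemma eq_iter_qcomm (B : algType F) (a : F) (x x' : nat -> B) lo hi :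
  (lo <= hi)%N -> (forall i, (lo <= i <= hi)%N -> x i = x' i) ->
  iter_qcomm a x lo hi = iter_qcomm a x' lo hi.
Proof.
move=> lohi xx'; rewrite /iter_qcomm (xx' lo) ?leqnn //.
have: all (fun i => lo <= i <= hi)%N (iota lo.+1 (hi - lo)).
  by apply/allP => i; rewrite mem_iota; lia.
elim: (iota _ _) (x' lo) => //= l s IH z /andP[hl hs].
by rewrite IH // xx'.
Qed.

Lemma natrep_iter_UF a lo hi : (1 <= lo <= hi)%N -> (hi <= n)%N ->
  pi (iter_qcomm a (UF n q) lo hi) =
  ((- a) ^+ (hi - lo) * q^-1 ^+ (hi - lo).+1) *: munit hi.+1 lo.
Proof.
move=> hlo hhi; rewrite natrep_iter_qcomm -iter_qcomm_munit //.
by apply: eq_iter_qcomm => [|i hi']; [lia | rewrite natrep_UF //; lia].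
Qed.

(** * The entries of $A$ and its commutant *)

Section Stabilizer.

Variables (m : nat) (y : nat -> F).
Hypothesis m_le : (m.*2 <= n.+1)%N.
Hypothesis y_inv : forall i : nat, (1 <= i <= n.+1)%N ->
  (i <= m)%N || (n.+2 - i <= m)%N -> y i * y (n.+2 - i)%N = q ^ (- (n.+1)%:Z).

Definition A_diag (i : nat) : F :=
  if (i <= m)%N then q ^ (- m%:Z) * (1 - q ^ (- n.+1%:Z + (2 * m)%:Z))
  else if (i < n.+2 - m)%N then q ^ (- m%:Z) else 0.

Definition A_anti (i : nat) : F :=
  if (i <= m)%N || (n.+2 - i <= m)%N then y i else 0.

Local Notation A := (A_mx n q m y).

Lemma A_mxE : A = dmx n A_diag + admx n A_anti.
Proof.
rewrite /A_mx; congr (_ + _).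
  rewrite /dmx [RHS](big_cat_nat (n := m.+1)) //=; last by lia.
  rewrite [X in _ = _ + X](big_cat_nat (n := (n.+2 - m)%N)) /=; try lia.
  rewrite [X in _ = _ + (_ + X)]big_nat_cond [X in _ = _ + (_ + X)]big1 ?addr0; last first.
    by move=> i hi; rewrite /A_diag !ifF ?scale0r //; lia.
  congr (_ + _); apply: eq_big_nat => i hi; rewrite /A_diag.
    by rewrite ifT //; lia.
  by rewrite ifF ?ifT //; lia.
rewrite /admx big_mkcond; apply: eq_bigr => i _; rewrite /A_anti.
by case: ifP; rewrite ?scale0r.
Qed.

Lemma munit_A i j : (1 <= j <= n.+1)%N ->
  munit i j * A = A_diag j *: munit i j + A_anti j *: munit i (n.+2 - j)%N.
Proof. by move=> hj; rewrite A_mxE mulrDr munit_dmx munit_admx. Qed.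

Lemma A_munit i j : (1 <= i <= n.+1)%N ->
  A * munit i j =
  A_diag i *: munit i j + A_anti (n.+2 - i)%N *: munit (n.+2 - i)%N j.
Proof. by move=> hi; rewrite A_mxE mulrDl dmx_munit admx_munit. Qed.

Lemma dmx_A (w : nat -> F) :
  (forall i, (1 <= i <= m)%N -> w i = w (n.+2 - i)%N) ->
  dmx n w * A = A * dmx n w.
Proof.
move=> hw; rewrite A_mxE mulrDr mulrDl dmxC dmx_admxC // => i hi.
rewrite /A_anti; case: ifP => [|_]; last by rewrite eqxx.
case/orP=> him _; first by rewrite hw //; lia.
rewrite (hw (n.+2 - i)%N); last by lia.
by congr w; lia.
Qed.

Lemma y_neq0 i : (1 <= i <= n.+1)%N -> (i <= m)%N || (n.+2 - i <= m)%N ->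
  y i != 0.
Proof.
move=> hi him; apply/eqP => yi; have /eqP := y_inv hi him.
by rewrite yi mul0r eq_sym (negbTE (expfz_neq0 _ q_neq0)).
Qed.

(** Explicitly, $\tilde\alpha_i-\alpha_i$ is
    $\varepsilon_{i+1}+\varepsilon_{(i+1)'}-\varepsilon_i-\varepsilon_{i'}$ for outer $i$, and 0 for
    $i=m=N/2$. If $m<N/2$, it is $2\varepsilon_{m+1}-\varepsilon_m-\varepsilon_{m'}$ for $i=m$ and
    $\varepsilon_m+\varepsilon_{m'}-2\varepsilon_{N-m}$ for $i=N-m$. The only asymmetric terms lie
    in the middle block. *)
Lemma wt_tilde_sub_sym i : (1 <= i <= n)%N -> (i <= m)%N || (n.+1 - m <= i)%N ->
  forall j, (1 <= j <= m)%N ->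
  wt (tilde_alpha n m i - alpha n i) j =
  wt (tilde_alpha n m i - alpha n i) (n.+2 - j)%N.
Proof.
move=> hi him j hj; rewrite !wtB /tilde_alpha.
(* [rev] moves the reflection from $j$ to the other index; [neq] discards middle indices, as $j\le
   m$. *)
have rev a b : (a + b = n.+2)%N -> (n.+2 - j == a)%N = (j == b).
  by move=> ab; apply/eqP/eqP; lia.
have neq a : (m < a)%N -> (j == a) = false by lia.
case: ifP => h1.
  have hi' : (1 <= n.+1 - i <= n)%N by lia.
  rewrite !wt_alpha // (rev (n.+1 - i)%N i.+1); last by lia.
  rewrite (rev (n.+1 - i).+1 i); last by lia.
  rewrite (rev i (n.+1 - i).+1); last by lia.
  rewrite (rev i.+1 (n.+1 - i)%N); last by lia.
  by ring.
case: eqP => h2; first by have -> : i = m; [lia | rewrite !subrr].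
case: eqP => h3.
  rewrite {i}h3 in hi him h1 *.
  have hm : (1 <= m.+1 <= (n.+1 - m).+1)%N by lia.
  have hm' : ((n.+1 - m).+1 <= n.+1)%N by lia.
  rewrite !wt_alphas // !wt_alpha //.
  rewrite (rev (n.+1 - m).+1 m) 1?(rev m.+1 (n.+1 - m)%N) 1?(rev m (n.+2 - m)%N).
  - rewrite (neq m.+1) 1?(neq (n.+1 - m).+1) 1?(neq (n.+1 - m)%N) 1?(neq (n.+2 - m)%N);
      [by ring | lia ..].
  - lia.
  - lia.
  - lia.
have {h3}im : i = (n.+1 - m)%N by lia.
rewrite {i}im in hi him h1 *.
have hm : (1 <= m <= (n - m).+1)%N by lia.
have hm' : ((n - m).+1 <= n.+1)%N by lia.
rewrite !wt_alphas // !wt_alpha //.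
have -> : (n - m).+1 = (n.+1 - m)%N by lia.
rewrite (rev (n.+1 - m).+1 m) 1?(rev m (n.+2 - m)%N) 1?(rev (n.+1 - m)%N m.+1).
- rewrite (neq m.+1) 1?(neq (n.+1 - m).+1) 1?(neq (n.+1 - m)%N) 1?(neq (n.+2 - m)%N);
    [by ring | lia ..].
- lia.
- lia.
- lia.
Qed.

(** Written as a difference, this entry is the trace of the block of $A$ on $e_i,e_{i'}$, whose
    determinant is $-q^{-N}$; the eigenvalues are $q^{-m}$ and $-q^{m-N}$. *)
Lemma A_diag_lo i : (i <= m)%N ->
  A_diag i = q ^ (- m%:Z) - q ^ (m%:Z - n.+1%:Z).
Proof.
move=> him; rewrite /A_diag him mulrBr mulr1 -expfzDr //.
by congr (_ - q ^ _); lia.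
Qed.

Lemma A_diag_mid i : (m < i < n.+2 - m)%N -> A_diag i = q ^ (- m%:Z).
Proof. by move=> /andP[mi im]; rewrite /A_diag leqNgt mi im. Qed.

Lemma A_diag_hi i : (n.+2 - m <= i)%N -> A_diag i = 0.
Proof. by move=> hi; rewrite /A_diag !ifF //; lia. Qed.

Lemma A_anti_out i : (m < i < n.+2 - m)%N -> A_anti i = 0.
Proof. by move=> hi; rewrite /A_anti ifF //; lia. Qed.

Lemma A_anti_in i : (i <= m)%N || (n.+2 - i <= m)%N -> A_anti i = y i.
Proof. by move=> hi; rewrite /A_anti hi. Qed.

Lemma comb_munit_A (u v : F) i j k l :
  (1 <= i <= n.+1)%N -> (1 <= j <= n.+1)%N ->
  (1 <= k <= n.+1)%N -> (1 <= l <= n.+1)%N ->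
  u *: (A_diag j *: munit i j + A_anti j *: munit i (n.+2 - j)%N)
  + v *: (A_diag l *: munit k l + A_anti l *: munit k (n.+2 - l)%N) =
  u *: (A_diag i *: munit i j + A_anti (n.+2 - i)%N *: munit (n.+2 - i)%N j)
  + v *: (A_diag k *: munit k l + A_anti (n.+2 - k)%N *: munit (n.+2 - k)%N l)
    :> 'M[F]_n.+1 ->
  (u *: munit i j + v *: munit k l) * A = A * (u *: munit i j + v *: munit k l).
Proof.
move=> hi hj hk hl; rewrite -!munit_A // -!A_munit //.
by move: (A) => B; rewrite mulrDl mulrDr -!scalerAl -!scalerAr.
Qed.

(** * The generators $X_{\alpha_i}$ *)

Definition UX i : Uq n q :=
  qh q (tilde_alpha n m i - alpha n i) * Ue n q i
  + c_alpha n q m y i *: tilde_F n q m i.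

Lemma natrep_UX i : (1 <= i <= n)%N ->
  pi (UX i) = q ^ (wt (tilde_alpha n m i) i - 1) *: munit i i.+1
              + c_alpha n q m y i *: pi (tilde_F n q m i).
Proof.
move=> hi; rewrite /UX raddfD /= rmorphM /= natrep_qh natrep_e // dmx_munit.
by rewrite linearZ wtB wt_alpha // eqxx ltn_eqF.
Qed.

(** The image is $q^{-1}(e_{i,i+1}+c_{\alpha_i}e_{i',(i+1)'})$, and the antidiagonal part of $A$
    forces $c_{\alpha_i}y_i=y_{i+1}$. *)
Lemma UX_comm_outer i : (1 <= i <= n)%N -> (i < m)%N || (n.+1 - m < i)%N ->
  pi (UX i) * A = A * pi (UX i).
Proof.
move=> hi h1; rewrite natrep_UX // /tilde_alpha /c_alpha /tilde_F h1.
have hi' : (1 <= n.+1 - i <= n)%N by lia.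
rewrite wt_alpha // natrep_UF //.
have -> : (i == n.+1 - i)%N = false by lia.
have -> : (i == (n.+1 - i).+1)%N = false by lia.
have -> : (n.+1 - i).+1 = (n.+2 - i)%N by lia.
have -> : (n.+1 - i)%N = (n.+2 - i.+1)%N by lia.
have b1 : (1 <= i <= n.+1)%N by lia.
have b2 : (1 <= i.+1 <= n.+1)%N by lia.
have b3 : (1 <= n.+2 - i <= n.+1)%N by lia.
have b4 : (1 <= n.+2 - i.+1 <= n.+1)%N by lia.
have c1 : (i <= m)%N || (n.+2 - i <= m)%N by lia.
have c2 : (i.+1 <= m)%N || (n.+2 - i.+1 <= m)%N by lia.
rewrite subrr sub0r exprN1 scalerA; apply: comb_munit_A => //.
rewrite !subKn; try by apply: ltnW; rewrite ltnS; lia.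
(* Both $i$ and $i+1$ lie on the same side of the middle block, where the diagonal of $A$ is
   constant. *)
have -> : A_diag i.+1 = A_diag i.
  case: (leqP i m) => h; first by rewrite !A_diag_lo //; lia.
  by rewrite !A_diag_hi //; lia.
have -> : A_diag (n.+2 - i.+1) = A_diag (n.+2 - i)%N.
  case: (leqP i m) => h; first by rewrite !A_diag_hi //; lia.
  by rewrite !A_diag_lo //; lia.
have c3 : (n.+2 - i <= m)%N || (n.+2 - (n.+2 - i) <= m)%N by lia.
have c4 : (n.+2 - i.+1 <= m)%N || (n.+2 - (n.+2 - i.+1) <= m)%N by lia.
rewrite !A_anti_in //.
have y1 := y_neq0 b1 c1; have y2 := y_neq0 b2 c2.
have e1 : y (n.+2 - i)%N = q ^ (- n.+1%:Z) / y i.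
  by rewrite -(y_inv b1 c1) mulrAC divff ?mul1r.
have e2 : y (n.+2 - i.+1)%N = q ^ (- n.+1%:Z) / y i.+1.
  by rewrite -(y_inv b2 c2) mulrAC divff ?mul1r.
rewrite e1 e2; apply/matrixP => r s; rewrite !mxE.
by field; rewrite q_neq0 y1 y2.
Qed.

(** Here $A$ is purely antidiagonal and the image is $e_{m,m'}+(y_{m'}/y_m)e_{m',m}$. *)
Lemma UX_comm_half : (1 <= m <= n)%N -> n.+1 = m.*2 ->
  pi (UX m) * A = A * pi (UX m).
Proof.
move=> hi h2; have h1 : (m < m)%N || (n.+1 - m < m)%N = false by lia.
rewrite natrep_UX // /tilde_alpha /c_alpha /tilde_F h1.
have -> : n.+1 == m.*2 by apply/eqP.
have b1 : (1 <= m <= n.+1)%N by lia.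
have b2 : (1 <= m.+1 <= n.+1)%N by lia.
rewrite wt_alpha // natrep_UF // eqxx ltn_eqF // subr0 subrr expr0z scalerA.
apply: comb_munit_A => //.
have -> : (n.+2 - m = m.+1)%N by lia.
have -> : (n.+2 - m.+1 = m)%N by lia.
have -> : A_diag m.+1 = 0 by rewrite A_diag_hi //; lia.
have -> : A_diag m = 0.
  by rewrite A_diag_lo // (_ : m%:Z - _ = - m%:Z) ?subrr //; lia.
rewrite !A_anti_in ?leqnn //; last by lia.
have c1 : (m <= m)%N || (n.+2 - m <= m)%N by rewrite leqnn.
have ym := y_neq0 b1 c1.
have -> : y m.+1 = q ^ (- n.+1%:Z) / y m.
  rewrite -(y_inv b1 c1) mulrAC divff ?mul1r //; congr y; lia.
have -> : q ^ (- (2 * m)%:Z + 1) = q ^ (- n.+1%:Z) * q.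
  rewrite expfzDr // expr1z; congr (q ^ _ * q); lia.
apply/matrixP => r s; rewrite !mxE.
by field; rewrite q_neq0 ym.
Qed.

Lemma y_opp_m : (1 <= m)%N ->
  y (n.+2 - m)%N = q ^ (- m%:Z) * q ^ (m%:Z - n.+1%:Z) / y m.
Proof.
move=> m_gt0.
have b1 : (1 <= m <= n.+1)%N by lia.
have c1 : (m <= m)%N || (n.+2 - m <= m)%N by rewrite leqnn.
rewrite -expfzDr // addKr -(y_inv b1 c1) mulrAC divff ?mul1r //.
exact: y_neq0 b1 c1.
Qed.

(** The sign in $c_{\alpha_i}$ cancels the signs of the $N-2m-1$ commutators in
    $F_{\tilde\alpha_i}$. *)
Lemma sign_width : (m.*2 < n.+1)%N ->
  (-1) ^+ n.+2 * (-1) ^+ (n - m.*2) = 1 :> F.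
Proof.
by move=> hm; rewrite -exprD -signr_odd (_ : odd _ = false) //; lia.
Qed.

(** The image is $q^{-1}$ times $e_{m,m+1}+(D/y_m)e_{m',m+1}$ with $D=q^{m-N}$: its only nonzero
    column is an eigenvector of $A$ for $q^{-m}$, the scalar by which $A$ acts from the right. *)
Lemma UX_comm_low : (1 <= m)%N -> (m.*2 < n.+1)%N ->
  pi (UX m) * A = A * pi (UX m).
Proof.
move=> d1 hm; have hi : (1 <= m <= n)%N by lia.
rewrite natrep_UX // /tilde_alpha /c_alpha /tilde_F.
have -> : (m < m)%N || (n.+1 - m < m)%N = false by lia.
have -> : (n.+1 == m.*2) = false by lia.
rewrite eqxx.
have b1 : (1 <= m <= n.+1)%N by lia.
have b2 : (1 <= n.+2 - m <= n.+1)%N by lia.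
have c1 : (m <= m)%N || (n.+2 - m <= m)%N by rewrite leqnn.
have ym := y_neq0 b1 c1; have sgn := sign_width hm.
set k := (n - m.*2)%N in sgn.
pose Q := q ^ (- m%:Z); pose D := q ^ (m%:Z - n.+1%:Z).
rewrite wt_alphas; [|lia|lia].
rewrite natrep_iter_UF; [|lia|lia].
have b3 : (1 <= m.+1 <= n.+1)%N by lia.
have -> : (m == m.+1) = false by lia.
have -> : (m == (n.+1 - m).+1) = false by lia.
have -> : (n.+1 - m).+1 = (n.+2 - m)%N by lia.
rewrite subr0 sub0r exprN1 scalerA; apply: comb_munit_A => //.
rewrite subKn; last by lia.
have -> : (n.+1 - m - m.+1 = n - m.*2)%N by lia.
have -> : (-1) ^+ n.+2 * q ^ (- n.+1%:Z + m%:Z) / y m *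
          ((- q) ^+ k * q^-1 ^+ k.+1) = D / q / y m.
  rewrite (_ : - n.+1%:Z + m%:Z = m%:Z - n.+1%:Z); last by rewrite addrC.
  rewrite -/D [(- q) ^+ _]exprNn (exprSr q^-1) exprVn.
  transitivity ((-1) ^+ n.+2 * (-1) ^+ k * (q ^+ k * (q ^+ k)^-1) * (D / q / y m)).
    by ring.
  by rewrite sgn divff ?expf_neq0 // !mul1r.
rewrite (A_diag_lo (leqnn m)) (A_diag_mid (i := m.+1)); last by lia.
rewrite (A_diag_hi (leqnn _)) A_anti_out; last by lia.
rewrite !A_anti_in //; last by lia.
rewrite (y_opp_m d1) -/Q -/D; apply/matrixP => r s; rewrite !mxE.
by field; rewrite q_neq0 ym.
Qed.

(** Dually, the image is $q^{-2}$ times $e_{N-m,m'}+(Q/y_m)e_{N-m,m}$ with $Q=q^{-m}$: its only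
    nonzero row is a left eigenvector of $A$ for $Q$. *)
Lemma UX_comm_high : (1 <= m)%N -> (m.*2 < n.+1)%N ->
  pi (UX (n.+1 - m)%N) * A = A * pi (UX (n.+1 - m)%N).
Proof.
move=> d1 hm; have hi : (1 <= n.+1 - m <= n)%N by lia.
rewrite natrep_UX // /tilde_alpha /c_alpha /tilde_F.
have -> : (n.+1 - m < m)%N || (n.+1 - m < n.+1 - m)%N = false by lia.
have -> : (n.+1 == m.*2) = false by lia.
have -> : (n.+1 - m == m)%N = false by lia.
have b1 : (1 <= m <= n.+1)%N by lia.
have b2 : (1 <= n.+2 - m <= n.+1)%N by lia.
have c1 : (m <= m)%N || (n.+2 - m <= m)%N by rewrite leqnn.
have ym := y_neq0 b1 c1; have sgn := sign_width hm.
set k := (n - m.*2)%N in sgn.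
pose Q := q ^ (- m%:Z); pose D := q ^ (m%:Z - n.+1%:Z).
have nm : (n - m).+1 = (n.+1 - m)%N by lia.
rewrite wt_alphas; [|lia|lia].
rewrite natrep_iter_UF; [|lia|lia].
rewrite nm eqxx.
have -> : (n.+1 - m == m)%N = false by lia.
have -> : (n.+1 - m).+1 = (n.+2 - m)%N by lia.
have b3 : (1 <= n.+1 - m <= n.+1)%N by lia.
rewrite scalerA; apply: comb_munit_A => //.
rewrite subKn; last by lia.
have -> : (n - m - m = n - m.*2)%N by lia.
(* The commutators contribute $q^{-(2k+1)}$ with $k=N-2m-1$, which lowers the exponent $2N-5m-3$ to
   $-m-2$. *)
have -> : (-1) ^+ n.+2 * q ^ ((2 * n.+1)%:Z - (5 * m)%:Z - 3) / y m *
          ((- q^-1) ^+ k * q^-1 ^+ k.+1) = Q * q ^ (- 2) / y m.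
  have -> : (- q^-1) ^+ k * q^-1 ^+ k.+1 = (-1) ^+ k * q ^ (- (2 * k + 1)%N%:Z).
    rewrite [(- q^-1) ^+ _]exprNn -mulrA -exprD exprVn -exprnN.
    by congr (_ * (q ^+ _)^-1); lia.
  transitivity ((-1) ^+ n.+2 * (-1) ^+ k *
     (q ^ ((2 * n.+1)%:Z - (5 * m)%:Z - 3) * q ^ (- (2 * k + 1)%N%:Z)) / y m).
    by move: (q ^ _) (q ^ _) => a b; ring.
  rewrite sgn mul1r -!expfzDr //; congr (q ^ _ / _); lia.
rewrite (A_diag_lo (leqnn m)) (A_diag_hi (leqnn _)) A_diag_mid; last by lia.
rewrite (A_anti_out (i := (n.+2 - (n.+1 - m))%N)); last by lia.
rewrite !A_anti_in //; last by lia.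
rewrite (y_opp_m d1) -/Q -/D.
rewrite (_ : false%:Z - true%:Z - 1 = - 2 :> int) //.
move: (q ^ (- 2)) => E; apply/matrixP => r s; rewrite !mxE.
by field.
Qed.

Lemma UX_comm i : (1 <= i <= n)%N -> (i <= m)%N || (n.+1 - m <= i)%N ->
  pi (UX i) * A = A * pi (UX i).
Proof.
move=> hi him; have [h1|h1] := boolP ((i < m)%N || (n.+1 - m < i)%N).
  exact: UX_comm_outer.
have [h2|h2] := eqVneq n.+1 m.*2.
  by have im : i = m by [lia]; rewrite im in hi *; apply: UX_comm_half.
have [->|h3] := eqVneq i m; first by apply: UX_comm_low; lia.
have -> : i = (n.+1 - m)%N by lia.
by apply: UX_comm_high; lia.
Qed.

(** * From generators to the whole subalgebra *)

Lemma Uk_comm x : Uk m y x -> pi x * A = A * pi x.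
Proof.
elim=> {x} [x Sx||x z _ IHx _ IHz|x z _ IHx _ IHz|a x _ IHx]; last first.
- by move: (A) IHx => B IHx; rewrite linearZ /= -scalerAl -scalerAr IHx.
- by rewrite rmorphM /= -mulrA IHz !mulrA IHx.
- by move: (A) IHx IHz => B IHx IHz; rewrite raddfD /= mulrDl mulrDr IHx IHz.
- by rewrite rmorph1 mul1r mulr1.
case: Sx => {x} i hi.
- rewrite natrep_e ?munit_A ?A_munit; try lia.
  by rewrite !A_diag_mid ?A_anti_out ?scale0r //; lia.
- rewrite natrep_f ?munit_A ?A_munit; try lia.
  by rewrite !A_diag_mid ?A_anti_out ?scale0r //; lia.
- rewrite natrep_K; last by lia.
  by apply: dmx_A => j hj; congr (q ^ (_%:Z - _%:Z)); lia.
- rewrite natrep_Kinv; last by lia.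
  by apply: dmx_A => j hj; congr (q ^ (- (_%:Z - _%:Z))); lia.
- exact: UX_comm.
- move=> him; rewrite natrep_qh; apply: dmx_A => j hj.
  by rewrite (wt_tilde_sub_sym hi him).
- move=> him; rewrite natrep_qh; apply: dmx_A => j hj.
  by rewrite !wtN (wt_tilde_sub_sym hi him).
Qed.

End Stabilizer.

End Representation.

Theorem mainTheorem3 (R : realType) (n m : nat) (q : R[i])
  (q_neq0 : q != 0)
  (q_nroot : forall k : nat, (0 < k)%N -> ~~ k.-unity_root q)
  (y : nat -> R[i]) (A : 'M[R[i]]_n.+1) :
  (m.*2 <= n.+1)%N ->
  (forall i : nat, (1 <= i <= n.+1)%N -> (i <= m)%N || (n.+2 - i <= m)%N ->
     y i * y (n.+2 - i)%N = q ^ (- (n.+1)%:Z)) ->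
  A = A_mx n q m y \/ A = - A_mx n q m y ->
  forall x : Uq n q, Uk m y x ->
    natrep q_neq0 q_nroot x *m A = A *m natrep q_neq0 q_nroot x.
Proof.
move=> m_le y_inv hA x /(Uk_comm q_neq0 q_nroot m_le y_inv) comm_x.
case: hA => ->; first exact: comm_x.
by rewrite mulmxN mulNmx; congr (- _); apply: comm_x.
Qed.
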